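(* Let $r,s\geq 1$, $n\geq 2$ be integers. If $H(r,n,s)$ is a connected LOG group then one of the following holds: (a) $r=s$ and $\gcd(r,n)=1$, in which case $H(r,n,s)\cong \langle a,b \mid a^n=b^r\rangle$, the fundamental group of the complement of the $(r,n)$-torus knot in $S^3$; (b) $\gcd(r,n,s)=2$, $|r-s|=2$ and either $r\equiv 0 \bmod n$ or $s\equiv 0 \bmod n$, in which case $H(r,n,s)\cong \mathbb{Z}$; (c) $\gcd(r,n,s)=2$, $|r-s|=2$, $\{r,s\}\neq\{4,2\}$, $\gcd(n,r+s)=2$, $r\not\equiv 0 \bmod n$, $s\not\equiv 0 \bmod n$, and the group $H(r/2,n/2,s/2)$ is perfect.
   Context: For integers $r,s\geq 1$, $n\geq 2$, the generalized Fibonacci group $H(r,n,s)$ is the group with generators $x_0,\ldots,x_{n-1}$ and defining relations $x_i x_{i+1}\cdots x_{i+r-1}=x_{i+r}x_{i+r+1}\cdots x_{i+r+s-1}$ for $0\leq i<n$, with subscripts taken mod $n$. A Labelled Oriented Graph (LOG) consists of a finite graph (possibly with loops and multiple edges) with vertex set $V$ and edge set $E$ together with three maps $\iota,\tau,\lambda:E\to V$ (the initial vertex map, terminal vertex map and labelling map). It determines the LOG presentation $\langle V \mid \tau(e)^{-1}\lambda(e)^{-1}\iota(e)\lambda(e)\ (e\in E)\rangle$. A connected LOG group is a group that admits a LOG presentation arising from a LOG whose underlying graph is connected. A group $G$ is perfect if its abelianization $G^{\mathrm{ab}}$ is trivial. *)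

(* Defs.v *)
From HB Require Import structures.
From mathcomp Require Import all_boot all_order ssralg ssrnum ssrint.
From mathcomp Require Import boolp classical_sets.

Set Implicit Arguments.
Unset Strict Implicit.
Unset Printing Implicit Defensive.

Local Open Scope quotient_scope.
Local Open Scope classical_set_scope.
Local Open Scope group_scope.

Section Subgroups.
Variable G : groupType.
Implicit Types (A H N : set G) (x y : G).

Definition is_subgroup H : Prop :=
  [/\ H 1, forall x y, H x -> H y -> H (x * y) & forall x, H x -> H x^-1].

Definition is_normal N : Prop :=
  is_subgroup N /\ forall x y, N x -> N (x ^ y).

Definition normal_closure A : set G := smallest is_normal A.

Definition commutators : set G := [set g | exists x y, g = [~ x, y]].

Definition commutator_subgroup : set G := smallest is_subgroup commutators.

Lemma normal_closure_normal A : is_normal (normal_closure A).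
Proof.
split; first split.
- by move=> N [[[N1 _ _] _] _].
- move=> x y Nx Ny N NA; have [[[_ NM _] _] _] := NA.
  by apply: NM; [exact: Nx | exact: Ny].
- by move=> x Nx N NA; have [[[_ _ NV] _] _] := NA; apply: NV; exact: Nx.
- by move=> x y Nx N NA; have [[_ NJ] _] := NA; apply: NJ; exact: Nx.
Qed.

Lemma commutator_subgroup_normal : is_normal commutator_subgroup.
Proof.
have subD : is_subgroup commutator_subgroup.
  split.
  - by move=> N [[N1 _ _] _].
  - move=> x y Nx Ny N NA; have [[_ NM _] _] := NA.
    by apply: NM; [exact: Nx | exact: Ny].
  - by move=> x Nx N NA; have [[_ _ NV] _] := NA; apply: NV; exact: Nx.
split=> // x y Dx.
have -> : x ^ y = x * [~ x, y] by rewrite /commg mulgA mulgV mul1g.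
case: subD => _ DM _. apply: (DM _ _ Dx).
by apply: sub_gen_smallest; exists x, y.
Qed.

End Subgroups.

Section QuotientGroup.
Variables (G : groupType) (N : set G).
Hypothesis normN : is_normal N.

Definition coset_eq (x y : G) : bool := `[< N (x^-1 * y) >].

Fact coset_eq_refl : reflexive coset_eq.
Proof. by move=> x; apply/asboolP; rewrite mulVg; case: normN => -[]. Qed.

Fact coset_eq_sym : symmetric coset_eq.
Proof.
have [[_ _ NV] _] := normN.
by move=> x y; apply/asboolP/asboolP => /NV; rewrite invgM invgK.
Qed.

Fact coset_eq_trans : transitive coset_eq.
Proof.
have [[_ NM _] _] := normN.
move=> y x z /asboolP Nxy /asboolP Nyz; apply/asboolP.
by have := NM _ _ Nxy Nyz; rewrite -mulgA mulVKg.
Qed.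

Definition coset_equiv := EquivRel coset_eq coset_eq_refl coset_eq_sym
  coset_eq_trans.

Definition quotient_group := {eq_quot coset_equiv}.
HB.instance Definition _ : EqQuotient _ coset_equiv quotient_group :=
  EqQuotient.on quotient_group.
HB.instance Definition _ := Choice.on quotient_group.

Let mul (a b : quotient_group) : quotient_group :=
  \pi_quotient_group (repr a * repr b).
Let inv (a : quotient_group) : quotient_group :=
  \pi_quotient_group (repr a)^-1.

Let coset (x : G) : quotient_group := \pi_quotient_group x.

Let cosetP (x y : G) : N (x^-1 * y) -> coset x = coset y.
Proof.
by move=> Nxy; apply/(eqmodP coset_equiv); apply/asboolP.
Qed.

Let reprP (x : G) : N (x^-1 * repr (coset x)).
Proof.
apply/asboolP; apply/(eqmodP coset_equiv).
exact/esym/reprK.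
Qed.

Let mulE x y : mul (coset x) (coset y) = coset (x * y).
Proof.
have [[_ NM NV] NJ] := normN; apply/esym/cosetP.
have := NM _ _ (NJ _ y (reprP x)) (reprP y).
by rewrite /conjg invgM !mulgA mulgK.
Qed.

Let invE x : inv (coset x) = coset x^-1.
Proof.
have [[_ NM NV] NJ] := normN; apply/esym/cosetP; rewrite invgK.
have := NV _ (NJ _ x^-1 (reprP x)).
by rewrite /conjg invgK !mulgA mulgV mul1g invgM invgK.
Qed.

Let cosetW (a : quotient_group) : a = coset (repr a).
Proof. exact/esym/reprK. Qed.

Fact quotient_mulA : associative mul.
Proof.
by move=> a b c; rewrite (cosetW a) (cosetW b) (cosetW c) !mulE mulgA.
Qed.
Fact quotient_mul1 : left_id (coset 1) mul.
Proof. by move=> a; rewrite (cosetW a) mulE mul1g. Qed.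
Fact quotient_mulr1 : right_id (coset 1) mul.
Proof. by move=> a; rewrite (cosetW a) mulE mulg1. Qed.
Fact quotient_mulV : left_inverse (coset 1) inv mul.
Proof. by move=> a; rewrite (cosetW a) invE mulE mulVg. Qed.
Fact quotient_mulrV : right_inverse (coset 1) inv mul.
Proof. by move=> a; rewrite (cosetW a) invE mulE mulgV. Qed.

HB.instance Definition _ := isGroup.Build quotient_group
  quotient_mulA quotient_mul1 quotient_mulr1 quotient_mulV quotient_mulrV.

End QuotientGroup.

(* The free group on X: words in the letters x = (x, true) and
   x^-1 = (x, false), modulo free cancellation. *)
Section FreeGroup.
Variable X : choiceType.
Implicit Types u v w : seq (X * bool).

Inductive free_equiv : seq (X * bool) -> seq (X * bool) -> Prop :=
| free_equiv_refl u : free_equiv u u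
| free_equiv_sym u v : free_equiv u v -> free_equiv v u
| free_equiv_trans v u w : free_equiv u v -> free_equiv v w -> free_equiv u w
| free_equiv_cancel u x b v :
    free_equiv (u ++ [:: (x, b); (x, ~~ b)] ++ v) (u ++ v).

Definition free_eq u v : bool := `[< free_equiv u v >].

Definition word_inv w := rev [seq (l.1, ~~ l.2) | l <- w].

Let equivL w u v : free_equiv u v -> free_equiv (w ++ u) (w ++ v).
Proof.
elim=> {u v} [u|u v _ |v u t _ + _|u x b v]; first exact: free_equiv_refl.
- exact: free_equiv_sym.
- exact: free_equiv_trans.
- by rewrite !(catA w); exact: free_equiv_cancel.
Qed.

Let equivR w u v : free_equiv u v -> free_equiv (u ++ w) (v ++ w).
Proof.
elim=> {u v} [u|u v _ |v u t _ + _|u x b v]; first exact: free_equiv_refl.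
- exact: free_equiv_sym.
- exact: free_equiv_trans.
- by rewrite -!catA; exact: free_equiv_cancel.
Qed.

Let equivM u u' v v' :
  free_equiv u u' -> free_equiv v v' -> free_equiv (u ++ v) (u' ++ v').
Proof.
move=> uu' vv'; apply: (@free_equiv_trans (u' ++ v)); first exact: equivR.
exact: equivL.
Qed.

Let word_invM u v : word_inv (u ++ v) = word_inv v ++ word_inv u.
Proof. by rewrite /word_inv map_cat rev_cat. Qed.

Let equivV u v : free_equiv u v -> free_equiv (word_inv u) (word_inv v).
Proof.
elim=> {u v} [u|u v _ |v u t _ + _|u x b v]; first exact: free_equiv_refl.
- exact: free_equiv_sym.
- exact: free_equiv_trans.
- have invb : word_inv [:: (x, b); (x, ~~ b)] = [:: (x, b); (x, ~~ b)].
    by rewrite /word_inv /rev /= negbK.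
  by rewrite !word_invM -catA invb; exact: free_equiv_cancel.
Qed.

Let word_mulV u : free_equiv (u ++ word_inv u) [::].
Proof.
elim: u => [|[x b] u IHu]; first exact: free_equiv_refl.
rewrite -cat1s word_invM -catA (catA u).
apply: (@free_equiv_trans ([:: (x, b)] ++ [::] ++ word_inv [:: (x, b)])).
  exact/equivL/equivR.
exact: (free_equiv_cancel [::] x b [::]).
Qed.

Let word_invK u : word_inv (word_inv u) = u.
Proof.
rewrite /word_inv map_rev revK -map_comp -[RHS]map_id.
by apply: eq_map => -[x b] /=; rewrite negbK.
Qed.

Let word_Vmul u : free_equiv (word_inv u ++ u) [::].
Proof. by rewrite -{2}[u]word_invK; exact: word_mulV. Qed.

Fact free_eq_refl : reflexive free_eq.
Proof. by move=> u; apply/asboolP; exact: free_equiv_refl. Qed.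
Fact free_eq_sym : symmetric free_eq.
Proof. by move=> u v; apply/asboolP/asboolP; exact: free_equiv_sym. Qed.
Fact free_eq_trans : transitive free_eq.
Proof.
by move=> v u w /asboolP uv /asboolP vw; apply/asboolP;
  exact: free_equiv_trans uv vw.
Qed.

Definition free_equiv_rel := EquivRel free_eq free_eq_refl free_eq_sym
  free_eq_trans.

Definition free_group := {eq_quot free_equiv_rel}.
HB.instance Definition _ : EqQuotient _ free_equiv_rel free_group :=
  EqQuotient.on free_group.
HB.instance Definition _ := Choice.on free_group.

Definition free_gen (x : X) : free_group := \pi_free_group [:: (x, true)].

Let cls u : free_group := \pi_free_group u.
Let mul (a b : free_group) : free_group := cls (repr a ++ repr b).
Let inv (a : free_group) : free_group := cls (word_inv (repr a)).

Let clsP u v : free_equiv u v -> cls u = cls v.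
Proof.
by move=> uv; apply/(eqmodP free_equiv_rel);
  apply/asboolP.
Qed.

Let reprP u : free_equiv (repr (cls u)) u.
Proof.
apply/asboolP; apply/(eqmodP free_equiv_rel).
exact/reprK.
Qed.

Let mulE u v : mul (cls u) (cls v) = cls (u ++ v).
Proof. by apply/clsP/equivM; exact: reprP. Qed.

Let invE u : inv (cls u) = cls (word_inv u).
Proof. by apply/clsP/equivV; exact: reprP. Qed.

Let clsW (a : free_group) : a = cls (repr a).
Proof. exact/esym/reprK. Qed.

Fact free_mulA : associative mul.
Proof. by move=> a b c; rewrite (clsW a) (clsW b) (clsW c) !mulE catA. Qed.
Fact free_mul1 : left_id (cls [::]) mul.
Proof. by move=> a; rewrite (clsW a) mulE. Qed.
Fact free_mulr1 : right_id (cls [::]) mul.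
Proof. by move=> a; rewrite (clsW a) mulE cats0. Qed.
Fact free_mulV : left_inverse (cls [::]) inv mul.
Proof. by move=> a; rewrite (clsW a) invE mulE; exact: clsP. Qed.
Fact free_mulrV : right_inverse (cls [::]) inv mul.
Proof. by move=> a; rewrite (clsW a) invE mulE; exact: clsP. Qed.

HB.instance Definition _ := isGroup.Build free_group
  free_mulA free_mul1 free_mulr1 free_mulV free_mulrV.

End FreeGroup.

(* < X | R >; a defining relation u = v is encoded by the relator u / v. *)
Definition presented_group (X : choiceType) (R : set (free_group X)) :
  groupType := quotient_group (normal_closure_normal R).

Definition isomorphic (G H : groupType) : Prop :=
  exists f : {multiplicative G -> H}, bijective f.

Definition isomorphic_to_Z (G : groupType) : Prop :=
  exists2 f : G -> int, {morph f : x y / x * y >-> (x + y)%R} & bijective f.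

Definition abelianization (G : groupType) : groupType :=
  quotient_group (commutator_subgroup_normal G).

Definition perfect (G : groupType) : Prop := forall a : abelianization G, a = 1.

(* The generator x_j of the free group on x_0, ..., x_(n-1), with subscript j
   taken mod n; the argument i : 'I_n only witnesses 0 < n. *)
Definition cyc_gen (n : nat) (i : 'I_n) (j : nat) : free_group 'I_n :=
  free_gen (Ordinal (ltn_pmod j (leq_ltn_trans (leq0n i) (ltn_ord i)))).

Definition fib_relator (r n s : nat) (i : 'I_n) : free_group 'I_n :=
  (\prod_(i <= j < i + r) cyc_gen i j) /
  (\prod_(i + r <= j < i + r + s) cyc_gen i j).

Definition gen_fib_group (r n s : nat) : groupType :=
  presented_group (range (@fib_relator r n s)).

Record LOG := MkLOG {
  log_vertex : finType;
  log_edge : finType;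
  log_init : log_edge -> log_vertex;
  log_term : log_edge -> log_vertex;
  log_label : log_edge -> log_vertex
}.

Definition log_adj (L : LOG) : rel (log_vertex L) := fun u v =>
  [exists e : log_edge L, ((log_init e == u) && (log_term e == v))
                       || ((log_init e == v) && (log_term e == u))].

(* Connectedness of the underlying undirected graph; the empty graph does not
   count as connected. *)
Definition log_connected (L : LOG) : Prop :=
  (0 < #|log_vertex L|)%N /\ forall u v, connect (@log_adj L) u v.

Definition log_relator (L : LOG) (e : log_edge L) : free_group (log_vertex L) :=
  (free_gen (log_term e))^-1 * (free_gen (log_label e))^-1
    * free_gen (log_init e) * free_gen (log_label e).

Definition log_group (L : LOG) : groupType :=
  presented_group (range (@log_relator L)).

Definition connected_LOG_group (G : groupType) : Prop :=
  exists2 L : LOG, log_connected L & isomorphic G (log_group L).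

(* < a, b | a^n = b^r >, with a = free_gen true and b = free_gen false; for
   coprime r and n it is the group of the (r, n)-torus knot. *)
Definition torus_knot_group (r n : nat) : groupType :=
  presented_group [set free_gen true ^+ n / free_gen false ^+ r].

(* Main.v *)
From HB Require Import structures.
Require Import Defs.
From mathcomp Require Import all_boot all_order ssralg ssrnum ssrint zmodp.
From mathcomp Require Import boolp classical_sets.
From mathcomp Require Import zify ring.

(* In a connected LOG group all generators are conjugate, so every homomorphism
   to an abelian group is a multiple of one integer-valued homomorphism.  Thus,
   for some nonzero psi : nat -> int, every n-periodic sequence in an abelian
   group satisfying the relations of H(r,n,s) additively is a multiple of psi.
   Everything beyond the two isomorphisms is read off this rank one property:
   - a sequence in F_2 x F_2 of period gcd(n,r+s) rules out gcd(n,r+s) > 2;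
   - differences of consecutive relations give 2 psi(i+r) = psi(i) + psi(i+r+s),
     so the indices where psi is maximal are closed under translation by r and
     s; gcd(r,n,s) = 1 would make psi constant, which forces r = s;
   - if r, n, s are even, the sequence (1,0), (-1,1), (1,0), ... over Z/q shows
     that r/2 and s/2 are incongruent mod every q > 1, so |r - s| = 2;
   - a sequence h for H(r/2,n/2,s/2) is the sequence of sums a(2i) + a(2i+1)
     of a sequence a for H(r,n,s) with a(2i+1) + a(2i+2) = 0, so h = 0;
     for {r,s} = {4,2} a Fibonacci sequence modulo a prime contradicts it.
   For r = s and gcd(r,n) = 1, all subwords of length r are equal to one element
   y; with w = x_0...x_{n-1} and ur = vn + 1, one gets
   x_0...x_{k-1} = w^(-vk) y^(uk), and y^n = w^r. *)

Set Implicit Arguments.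
Unset Strict Implicit.
Unset Printing Implicit Defensive.

Import GRing.Theory Num.Theory.

Notation "{ 'gmorph' G -> H }" := (UMagmaMorphism.type G H)
  (at level 0, G at level 98, H at level 99) : type_scope.

(** * Universal properties of quotients, free groups and presentations *)

Section GroupPresentations.
Local Open Scope quotient_scope.
Local Open Scope group_scope.

Lemma gmorph_of_morph (G H : groupType) (f : G -> H) :
  {morph f : x y / x * y} -> exists g : {gmorph G -> H}, g =1 f.
Proof.
move=> fM.
have fF : {morph f : x y / x / y}.
  move=> x y; apply: (mulIg (f y)); rewrite -fM.
  by rewrite !mulgVK.
pose fg := isGroupMorphism.Build G H f fF.
by exists (HB.pack f fg : {gmorph G -> H}).
Qed.

Lemma isomorphic_of_can (G H : groupType) (f : {gmorph G -> H}) (g : H -> G) :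
  cancel f g -> cancel g f -> isomorphic G H.
Proof. by move=> fK gK; exists f; exists g. Qed.

Section QuotientGroup.
Variables (G : groupType) (N : set G) (normN : is_normal N).

Definition quot_pi (x : G) : quotient_group normN :=
  \pi_(quotient_group normN) x.

Lemma quot_pi_eq x y : quot_pi x = quot_pi y <-> N (x^-1 * y).
Proof.
split; first by move=> /(eqmodP (coset_equiv normN)) /asboolP.
by move=> Nxy; apply/(eqmodP (coset_equiv normN))/asboolP.
Qed.

Lemma quot_piK a : quot_pi (repr a) = a. Proof. exact: reprK. Qed.

Lemma quot_piM : {morph quot_pi : x y / x * y}.
Proof.
have [[_ NM NV] NJ] := normN.
have reprN x : N (x^-1 * repr (quot_pi x)).
  by apply/quot_pi_eq; rewrite quot_piK.
move=> x y; apply/quot_pi_eq.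
have := NM _ _ (NJ _ y (reprN x)) (reprN y).
by rewrite /conjg invgM !mulgA mulgK.
Qed.

Lemma quot_piF : {morph quot_pi : x y / x / y}.
Proof.
by move=> x y; apply: (mulIg (quot_pi y)); rewrite -quot_piM !mulgVK.
Qed.

Lemma quot_lift (H : groupType) (f : {gmorph G -> H}) :
    (forall x, N x -> f x = 1) ->
  exists g : {gmorph quotient_group normN -> H}, forall x, g (quot_pi x) = f x.
Proof.
move=> fN.
have fK x : f (repr (quot_pi x)) = f x.
  apply/esym/eqP; rewrite -[_ == _](inj_eq (mulgI (f x)^-1)) mulVg eq_sym.
  by rewrite -gmulfV -gmulfM fN //; apply/quot_pi_eq; rewrite quot_piK.
have [|g gE] := @gmorph_of_morph (quotient_group normN) H (f \o repr).
  move=> a b /=; rewrite -{1}(quot_piK a) -{1}(quot_piK b) -quot_piM fK.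
  exact: gmulfM.
by exists g => x; rewrite gE /= fK.
Qed.

End QuotientGroup.

Section FreeGroup.
Variable X : choiceType.
Implicit Types u v w : seq (X * bool).

Definition free_cls u : free_group X := \pi_(free_group X) u.

Lemma free_cls_eq u v : free_cls u = free_cls v <-> free_equiv u v.
Proof.
split; first by move=> /(eqmodP (free_equiv_rel X)) /asboolP.
by move=> uv; apply/(eqmodP (free_equiv_rel X))/asboolP.
Qed.

Lemma free_clsK a : free_cls (repr a) = a. Proof. exact: reprK. Qed.

Lemma free_equiv_cat u u' v v' :
  free_equiv u u' -> free_equiv v v' -> free_equiv (u ++ v) (u' ++ v').
Proof.
move=> uu' vv'; apply: (@free_equiv_trans _ (u' ++ v)).
  elim: uu' => {u u' v' vv'} [u|u v' _|u v' t _ + _|u x b t].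
  - exact: free_equiv_refl.
  - exact: free_equiv_sym.
  - exact: free_equiv_trans.
  - by rewrite -!catA; exact: free_equiv_cancel.
elim: vv' => {u v v' uu'} [v|v v' _|u v t _ + _|u x b v].
- exact: free_equiv_refl.
- exact: free_equiv_sym.
- exact: free_equiv_trans.
- by rewrite !(catA u'); exact: free_equiv_cancel.
Qed.

Lemma free_cls_cat u v : free_cls (u ++ v) = free_cls u * free_cls v.
Proof.
by apply/free_cls_eq/free_equiv_cat; apply/free_cls_eq; rewrite free_clsK.
Qed.

Lemma free_cls_letter x b :
  free_cls [:: (x, b)] = if b then free_gen x else (free_gen x)^-1.
Proof.
case: b => //; apply/(mulIg (free_gen x)); rewrite mulVg.
have -> : free_gen x = free_cls [:: (x, true)] by [].
rewrite -free_cls_cat; apply/free_cls_eq.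
exact: (free_equiv_cancel [::] x false [::]).
Qed.

Lemma free_lift (H : groupType) (f : X -> H) :
  exists g : {gmorph free_group X -> H}, forall x, g (free_gen x) = f x.
Proof.
pose ev w := \prod_(l <- w) if l.2 then f l.1 else (f l.1)^-1.
have ev_eq u v : free_equiv u v -> ev u = ev v.
  elim=> {u v} [|u v _ ->|v u w _ -> _ ->|u x b v] //.
  rewrite /ev !big_cat !big_cons big_nil /= !mulg1; congr (_ * _).
  by case: b; rewrite /= ?mulVg ?mulgV mul1g.
have evE u : ev (repr (free_cls u)) = ev u.
  by apply/ev_eq/free_cls_eq; rewrite free_clsK.
have [|g gE] := @gmorph_of_morph (free_group X) H (ev \o repr).
  move=> a b /=; rewrite -{1}(free_clsK a) -{1}(free_clsK b) -free_cls_cat evE.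
  by rewrite /ev big_cat.
by exists g => x; rewrite gE /= evE /ev big_seq1.
Qed.

Lemma free_gmorph_ext (H : groupType) (f g : {gmorph free_group X -> H}) :
  (forall x, f (free_gen x) = g (free_gen x)) -> f =1 g.
Proof.
move=> fg a; rewrite -(free_clsK a); elim: (repr a) => [|[x b] w IHw].
  by rewrite (_ : free_cls [::] = 1) ?gmulf1.
rewrite -cat1s free_cls_cat !gmulfM IHw free_cls_letter.
by case: b; rewrite ?gmulfV fg.
Qed.

End FreeGroup.

HB.instance Definition _ (G : groupType) (N : set G) (normN : is_normal N) :=
  isGroupMorphism.Build G (quotient_group normN) (@quot_pi G N normN)
    (quot_piF normN).

Section Presentation.
Variables (X : choiceType) (R : set (free_group X)).

Definition pres_pi : {gmorph free_group X -> presented_group R} :=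
  @quot_pi _ _ (normal_closure_normal R).

Definition pres_gen (x : X) : presented_group R := pres_pi (free_gen x).

Lemma pres_rel w : R w -> pres_pi w = 1.
Proof.
move=> Rw; rewrite -[RHS](gmulf1 (s := pres_pi)); apply/quot_pi_eq.
rewrite mulg1.
have [[_ _ NV] _] := normal_closure_normal R.
by apply: NV => N [_]; apply.
Qed.

Lemma pres_lift (H : groupType) (f : {gmorph free_group X -> H}) :
    (forall w, R w -> f w = 1) ->
  exists g : {gmorph presented_group R -> H}, forall w, g (pres_pi w) = f w.
Proof.
move=> fR; apply: quot_lift => w /(_ [set v | f v = 1]%classic); apply.
split=> //; split; first split=> /=.
- by rewrite gmulf1.
- by move=> x y fx fy; rewrite gmulfM fx fy mulg1.
- by move=> x fx; rewrite gmulfV fx invg1.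
- by move=> x y /= fx; rewrite gmulfJ fx conj1g.
Qed.

Lemma pres_gmorph_ext (H : groupType) (f g : {gmorph presented_group R -> H}) :
  (forall x, f (pres_gen x) = g (pres_gen x)) -> f =1 g.
Proof.
move=> fg a; rewrite -(quot_piK a) -[quot_pi _ _]/(pres_pi (repr a)).
by apply: (@free_gmorph_ext _ _ (f \o pres_pi) (g \o pres_pi)).
Qed.

End Presentation.

Definition window (G : groupType) (a : nat -> G) i r :=
  \prod_(k < r) a (i + k)%N.

(** Indices range over all of [nat] with period [n], so no subscript has to be reduced. *)
Definition fib_sequence (r n s : nat) (G : groupType) (a : nat -> G) : Prop :=
  (forall i, a (i + n)%N = a i) /\
  forall i, window a i r = window a (i + r) s.

Lemma windowE (G : groupType) (a : nat -> G) i r :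
  \prod_(i <= j < i + r) a j = window a i r.
Proof.
rewrite -{1}[i]add0n big_addn addKn big_mkord.
by apply: eq_bigr => k _; rewrite addnC.
Qed.

Lemma gmulf_window (G H : groupType) (f : {gmorph G -> H}) a i r :
  f (window a i r) = window (f \o a) i r.
Proof. exact: gmulf_prod. Qed.

Lemma periodic_mod (T : Type) (a : nat -> T) n :
  (forall i, a (i + n)%N = a i) -> forall i, a (i %% n) = a i.
Proof.
move=> an i; rewrite [in RHS](divn_eq i n) addnC.
by elim: (i %/ n) => [|k IHk]; rewrite ?addn0 // mulSnr addnA an.
Qed.

Lemma eq_cyc_gen n (i i' : 'I_n) j j' :
  (j %% n = j' %% n)%N -> cyc_gen i j = cyc_gen i' j'.
Proof. by move=> jj'; congr free_gen; apply: val_inj. Qed.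

Lemma cyc_gen_ord n (i j : 'I_n) : cyc_gen i j = free_gen j.
Proof. by congr free_gen; apply: val_inj; rewrite /= modn_small. Qed.

(** The universal property in terms of sequences. Later arguments reach H(r,n,s) only through these
    three clauses. *)
Lemma gen_fib_groupP r n s : 0 < n ->
  exists x : nat -> gen_fib_group r n s,
  [/\ fib_sequence r n s x,
      forall (H : groupType) (f g : {gmorph gen_fib_group r n s -> H}),
        (forall j, f (x j) = g (x j)) -> f =1 g
    & forall (H : groupType) (a : nat -> H), fib_sequence r n s a ->
        exists f : {gmorph gen_fib_group r n s -> H}, forall j, f (x j) = a j].
Proof.
move=> n_gt0; pose i0 := Ordinal n_gt0.
have cyc_genE (i : 'I_n) : cyc_gen i = cyc_gen i0.
  by apply/funext => j; exact: eq_cyc_gen.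
pose x j : gen_fib_group r n s := pres_pi _ (cyc_gen i0 j).
have x_per i : x (i + n)%N = x i.
  by rewrite /x (eq_cyc_gen i0 i0 (modnDr i n)).
have relE (i : 'I_n) (H : groupType) (f : {gmorph free_group 'I_n -> H}) :
    f (fib_relator r s i) =
      window (f \o cyc_gen i0) i r / window (f \o cyc_gen i0) (i + r) s.
  by rewrite /fib_relator cyc_genE !windowE gmulfF !gmulf_window.
exists x; split.
- split=> // i.
  rewrite -(periodic_mod (n := n) (a := fun i => window x i r)); last first.
    by move=> j; apply: eq_bigr => k _; rewrite addnAC x_per.
  rewrite -(periodic_mod (n := n) (a := fun i => window x (i + r) s)); last first.
    by move=> j; apply: eq_bigr => k _; rewrite (addnAC j) (addnAC _ n) x_per.
  have im : (i %% n < n)%N by rewrite ltn_mod.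
  have := relE (Ordinal im) _ (pres_pi (range (@fib_relator r n s))).
  rewrite pres_rel; last by exists (Ordinal im).
  by move/esym/divg1_eq.
- move=> H f g fg; apply: pres_gmorph_ext => i; have := fg i.
  by rewrite /x cyc_gen_ord.
- move=> H a [a_per a_rel]; have [f fE] := free_lift (fun i : 'I_n => a i).
  have facyc : f \o cyc_gen i0 = a.
    by apply/funext => j; rewrite /= fE /= periodic_mod.
  have [|g gE] := @pres_lift _ (range (@fib_relator r n s)) _ f.
    by move=> _ [i _ <-]; rewrite relE facyc a_rel mulgV.
  by exists g => j; rewrite gE -facyc.
Qed.

End GroupPresentations.

(** * Abelian quotients and the rank one property *)

Section Abelianization.
Local Open Scope group_scope.

(** A synonym to carry the additive structure, while the abelianization keeps its multiplicative
    one. *)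
Definition abel_zmod (G : groupType) : Type := abelianization G.
HB.instance Definition _ (G : groupType) := Choice.on (abel_zmod G).

Lemma abel_mulC (G : groupType) : commutative (@mul (abelianization G)).
Proof.
move=> a b; rewrite -(quot_piK a) -(quot_piK b) -!quot_piM; apply/quot_pi_eq.
apply: sub_gen_smallest; exists (repr b), (repr a).
by rewrite /commg /conjg invgM !mulgA.
Qed.

HB.instance Definition _ (G : groupType) :=
  GRing.isZmodule.Build (abel_zmod G) (@mulgA (abelianization G))
    (@abel_mulC G) (@mul1g (abelianization G)) (@mulVg (abelianization G)).

End Abelianization.

Section Sequences.
Local Open Scope group_scope.

Lemma fib_sequence_gmulf r n s (G H : groupType) (f : {gmorph G -> H}) a :
  fib_sequence r n s a -> fib_sequence r n s (f \o a).
Proof.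
move=> [a_per a_rel]; split=> i; first by rewrite /= a_per.
by rewrite -!gmulf_window a_rel.
Qed.

Lemma gmorph_const1 (G H : groupType) :
  exists f : {gmorph G -> H}, forall x, f x = 1.
Proof.
have [|f fE] := @gmorph_of_morph G H (fun=> 1); last by exists f.
by move=> x y; rewrite mulg1.
Qed.

Definition add_fib_sequence r n s (V : zmodType) (a : nat -> V) :=
  fib_sequence r n s (a : nat -> Algebra.to_multiplicative V).

(** The generators project to such a sequence in the abelianization; if it vanishes, the projection,
    which is onto, is trivial. *)
Lemma perfect_gen_fib_group r n s : 0 < n ->
    (forall (V : zmodType) (a : nat -> V), add_fib_sequence r n s a ->
      forall i, a i = 0%R) ->
  perfect (gen_fib_group r n s).
Proof.
move=> n_gt0 a0; have [x [x_fib x_gen _]] := gen_fib_groupP r s n_gt0.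
set G := gen_fib_group r n s in x x_fib x_gen *.
pose f : {gmorph G -> abelianization G} :=
  @quot_pi _ _ (commutator_subgroup_normal G).
have [e eE] := gmorph_const1 G (abelianization G).
move=> b; rewrite -(quot_piK b) -[quot_pi _ _]/(f _) -(eE (repr b)).
apply: x_gen => j; rewrite eE.
exact: (a0 (abel_zmod G) (f \o x) (fib_sequence_gmulf f x_fib)).
Qed.

(** [psi] lists the degrees of the generators under the homomorphism to the integers that sends
    every vertex of the LOG to 1. *)
Lemma connected_LOG_sequence r n s :
    0 < n -> connected_LOG_group (gen_fib_group r n s) ->
  exists psi : nat -> int,
  [/\ add_fib_sequence r n s psi, exists i, psi i <> 0%R
    & forall (V : zmodType) (a : nat -> V), add_fib_sequence r n s a ->
        exists c : V, forall i, a i = (c *~ psi i)%R].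
Proof.
move=> n_gt0; have [x [x_fib x_gen x_lift]] := gen_fib_groupP r s n_gt0.
case=> L [/card_gt0P[v0 _] L_conn] [f0 [f' f0K f'K]].
have f0M : {morph f0 : y z / y * z} by exact: gmulfM.
have [f fE] := gmorph_of_morph f0M.
have [g gE] := gmorph_of_morph (can2_gmulfM f0K f'K).
have [deg0 deg0E] :=
  @free_lift (log_vertex L) (Algebra.to_multiplicative int) (fun=> 1%R).
have [|deg degE] := @pres_lift _ (range (@log_relator L)) _ deg0.
  move=> _ [e _ <-]; rewrite /log_relator !gmulfM !gmulfV !deg0E.
  by [].
exists (deg \o f \o x); split.
- exact: (fib_sequence_gmulf (deg \o f) x_fib).
- apply/not_existsP => psi0.
  have [e eE] :=
    gmorph_const1 (gen_fib_group r n s) (Algebra.to_multiplicative int).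
  have deg_triv : (deg \o f) =1 e.
    apply: x_gen => j; rewrite eE; exact: contrapT (psi0 j).
  have := deg_triv (g (pres_gen _ v0)); rewrite /= fE gE f'K eE degE deg0E.
  by [].
- move=> V a /x_lift [h hE].
  pose phi : {gmorph log_group L -> Algebra.to_multiplicative V} := h \o g.
  pose c : V := phi (pres_gen _ v0).
  (* In an abelian group the label cancels from an edge relator, so both ends of the edge have the
     same image. *)
  have phi_edge e :
      phi (pres_gen _ (log_init e)) = phi (pres_gen _ (log_term e)).
    have e_rel : range (@log_relator L) (log_relator e) by exists e.
    have := congr1 phi (pres_rel e_rel).
    rewrite /log_relator !gmulfM !gmulfV gmulf1.
    rewrite -[LHS]/(- phi _ - phi _ + phi _ + phi _ :> V)%R addrAC subrK addrC.
    by move/subr0_eq.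
  have phi_c v : phi (pres_gen _ v) = c.
    apply/esym; have /connectP[p] := L_conn v0 v.
    rewrite /c; elim: p (v0) => [|u p IHp] w /=; first by move=> _ ->.
    move=> /andP[/existsP[e adj_e] up] /(IHp _ up).
    apply: etrans; case/orP: adj_e => /andP[/eqP<- /eqP<-].
      exact: phi_edge.
    exact: esym (phi_edge e).
  have [|m mE] := @gmorph_of_morph (log_group L)
    (Algebra.to_multiplicative V) (fun y => (c *~ deg y)%R).
    move=> y z; rewrite gmulfM; exact: mulrzDr.
  exists c => i; rewrite -hE -{1}(f0K (x i)) -fE -gE -mE.
  apply: (pres_gmorph_ext (f := phi)) => v.
  by rewrite mE phi_c degE deg0E.
Qed.

End Sequences.

(** * Products and sums over windows of a periodic sequence *)

Section Windows.
Variables (G : groupType) (a : nat -> G).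
Local Open Scope group_scope.

Lemma window0 i : window a i 0 = 1. Proof. exact: big_ord0. Qed.

Lemma windowS i r : window a i r.+1 = window a i r * a (i + r)%N.
Proof. exact: big_ord_recr. Qed.

Lemma windowD i r s : window a i (r + s) = window a i r * window a (i + r) s.
Proof.
elim: s => [|s IHs]; first by rewrite addn0 window0 mulg1.
by rewrite addnS !windowS IHs addnA mulgA.
Qed.

Lemma window_period n i r :
  (forall i, a (i + n)%N = a i) -> window a (i + n) r = window a i r.
Proof. by move=> an; apply: eq_bigr => k _; rewrite addnAC an. Qed.

Lemma windowX i d m :
  (forall j, window a (j + d) d = window a j d) ->
  window a i (m * d) = window a i d ^+ m.
Proof.
move=> aE; elim: m i => [|m IHm] i; first by rewrite window0 expg0.
by rewrite mulSn windowD IHm aE expgS.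
Qed.

End Windows.

Lemma periodicM (T : Type) (a : nat -> T) n :
  (forall i, a (i + n)%N = a i) -> forall k i, a (i + k * n)%N = a i.
Proof.
move=> an; elim=> [|k IHk] i; first by rewrite addn0.
by rewrite mulSn addnA IHk an.
Qed.

(* Closure under the differences needed for Bezout comes from adding multiples
   of n. *)
Lemma gcdn_closed (P : nat -> Prop) n a b :
    P 0%N -> (forall c d, P c -> P d -> P (c + d)%N) ->
    (forall c k, P (c + k * n)%N -> P c) -> 0 < n ->
  P a -> P b -> P (gcdn a b).
Proof.
move=> P0 PD Pn n_gt0 Pa Pb.
have PM c k : P c -> P (k * c)%N.
  by move=> Pc; elim: k => // k IHk; rewrite mulSn; apply: PD.
have [->|a_gt0] := posnP a; first by rewrite gcd0n.
have [u v uv _] := egcdnP b a_gt0.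
apply: (Pn _ (v * b)%N).
have -> : (gcdn a b + v * b * n = u * a + (n.-1 * v) * b)%N by nia.
by apply: PD; apply: PM.
Qed.

Section AdditiveWindows.
Local Open Scope ring_scope.
Variable V : zmodType.
Implicit Types a : nat -> V.

Definition wsum a i r : V := \sum_(k < r) a (i + k)%N.

Lemma add_fib_sequenceP r n s a :
  add_fib_sequence r n s a <->
  (forall i, a (i + n)%N = a i) /\ forall i, wsum a i r = wsum a (i + r) s.
Proof. by []. Qed.

Lemma wsum0 a i : wsum a i 0 = 0. Proof. exact: big_ord0. Qed.

Lemma wsumS a i r : wsum a i r.+1 = wsum a i r + a (i + r)%N.
Proof. exact: big_ord_recr. Qed.

Lemma wsumSl a i r : wsum a i r.+1 = a i + wsum a i.+1 r.
Proof.
rewrite /wsum big_ord_recl addn0; congr (_ + _).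
by apply: eq_bigr => k _; rewrite addSnnS.
Qed.

Lemma wsum_shift a i r : wsum a i.+1 r = wsum a i r - a i + a (i + r)%N.
Proof.
by apply: (addrI (a i)); rewrite -wsumSl wsumS addrA [a i + _]addrC subrK.
Qed.

Lemma wsumD a i r s : wsum a i (r + s) = wsum a i r + wsum a (i + r) s.
Proof. exact: (@windowD (Algebra.to_multiplicative V) a i r s). Qed.

Lemma wsum_const n a (i : nat) :
  (forall i, a (i + n)%N = a i) -> wsum a i n = wsum a 0 n.
Proof.
by move=> an; elim: i => // i <-; rewrite wsum_shift an subrK.
Qed.

Lemma wsum_mul_period n a i m :
  (forall i, a (i + n)%N = a i) -> wsum a i (m * n) = wsum a 0 n *+ m.
Proof.
move=> an; elim: m i => [|m IHm] i; first by rewrite wsum0.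
by rewrite mulSn wsumD IHm wsum_const // mulrS.
Qed.

Lemma wsum_double a i r :
  wsum a i (2 * r) = \sum_(k < r) (a (i + k.*2)%N + a (i + k.*2.+1)%N).
Proof.
elim: r => [|r IHr]; first by rewrite wsum0 big_ord0.
by rewrite mulnS addnC wsumD IHr big_ord_recr /= !wsumS wsum0 add0r mul2n
  -!addnA addn0 addn1.
Qed.

End AdditiveWindows.

(** * Consequences of the rank one property *)

Section CyclicSequences.
Local Open Scope ring_scope.
Variables (r n s : nat) (psi : nat -> int).
Hypothesis n_gt1 : (1 < n)%N.
Hypothesis psi_fib : add_fib_sequence r n s psi.
Hypothesis psi_neq0 : exists i, psi i <> 0.
Hypothesis psi_univ : forall (V : zmodType) (a : nat -> V),
  add_fib_sequence r n s a -> exists c : V, forall i, a i = c *~ psi i.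

(** If all terms are multiples of (c, d), then 1 = (c psi(i)) (d psi(j)) = (c psi(j)) (d psi(i)) =
    0. *)
Lemma no_free_pair (R : nzRingType) (a : nat -> R * R) i j :
  add_fib_sequence r n s a -> a i = (1, 0) -> (a j).2 = 1 -> False.
Proof.
move=> /psi_univ[[c d] aE] ai aj.
have fstM (m : int) : ((c, d) *~ m).1 = c *~ m by exact: (raddfMz fst).
have sndM (m : int) : ((c, d) *~ m).2 = d *~ m by exact: (raddfMz snd).
move: aj ai; rewrite !aE sndM => dj E.
have := fstM (psi i); have := sndM (psi i); rewrite E /= => di ci.
have /eqP := oner_neq0 R; apply.
by rewrite -[1]mulr1 {1}ci -dj mulrzAl mulrzAr -mulrzA [X in _ *~ X]mulrC mulrzA
  -mulrzAr -di mulr0 mul0rz.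
Qed.

Lemma gcdn_le2 : (gcdn n (r + s) <= 2)%N.
Proof.
rewrite leqNgt; apply/negP => g_gt2; set g := gcdn _ _ in g_gt2.
(* These entries sum to zero over a period, hence over every window whose length is a multiple of
   [g]. *)
pose b (i : nat) : 'F_2 * 'F_2 :=
  match i with 0 => (1, 0) | 1 => (0, 1) | 2 => (1, 1) | _ => 0 end.
pose a i := b (i %% g)%N.
have a_per i : a (i + g)%N = a i by rewrite /a modnDr.
have oppF2 (x : 'F_2 * 'F_2) : - x = x.
  by case: x => -[[|[|//]] ?] [[|[|//]] ?]; congr (_, _); apply: val_inj.
have a_sum0 : wsum a 0 g = 0.
  rewrite /wsum -(subnKC g_gt2) !big_ord_recl big1 ?addr0; last first.
    move=> k _.
    rewrite /a modn_small; first by [].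
    by have := ltn_ord k; rewrite ltn_subRL.
  by rewrite /a !modn_small;
    [congr (_, _); apply: val_inj | apply: leq_trans g_gt2 ..].
apply: (@no_free_pair _ a 0%N 1%N).
- apply/add_fib_sequenceP; split=> i.
    by rewrite /a -modnDmr (eqP (dvdn_gcdl n (r + s) : _ == 0)%N) addn0.
  (* In characteristic 2 the relation says that a window of length r + s sums to zero. *)
  apply/subr0_eq; rewrite oppF2 -wsumD.
  have /dvdnP[m ->] : (g %| r + s)%N by exact: dvdn_gcdr.
  by rewrite (wsum_mul_period _ _ a_per) a_sum0 mul0rn.
- by rewrite /a mod0n.
- by rewrite /a modn_small // ltnW.
Qed.

Lemma psi_half_modn q : (1 < q)%N -> ~~ odd r -> ~~ odd n -> ~~ odd s ->
  r./2 <> s./2 %[mod q].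
Proof.
move=> q_gt1 r_even n_even s_even rs.
(* Any two neighbours add up to (0, 1), so an even window sums to (0, half its length) wherever it
   starts. *)
pose a i : 'Z_q * 'Z_q := if odd i then (-1, 1) else (1, 0).
have a_sum i k : ~~ odd k -> wsum a i k = (0, (k./2)%:R).
  move=> k_even; have -> : k = (2 * k./2)%N.
    by rewrite -[LHS]odd_double_half (negPf k_even) mul2n.
  rewrite wsum_double mul2n half_double.
  rewrite (eq_bigr (fun=> (0, 1))) => [|j _]; last first.
    by rewrite /a addnS /= oddD odd_double addbF; case: odd;
      congr (_, _); rewrite /= ?addNr ?addrN ?add0r ?addr0.
  rewrite sumr_const card_ord.
  by elim: (k./2)%N => [|m IHm]; rewrite ?mulr0n // mulrS IHm; congr (_, _);
    rewrite /= ?add0r // mulrS.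
apply: (@no_free_pair _ a 0%N 1%N) => //.
apply/add_fib_sequenceP; split=> i.
  by rewrite /a oddD (negPf n_even) addbF.
rewrite !a_sum //; congr (_, _); apply: val_inj => /=.
by rewrite !val_Zp_nat.
Qed.

Lemma gcdn_neq1 : r != s -> gcdn (gcdn r n) s != 1%N.
Proof.
move=> r_neq_s; apply/eqP => g1; have n_gt0 := ltnW n_gt1.
have /add_fib_sequenceP[psi_per psi_rel] := psi_fib.
have psi_mid i : psi (i + r)%N *+ 2 = psi i + psi (i + r + s)%N.
  have := psi_rel i.+1; by rewrite addSn !wsum_shift psi_rel; lia.
have [i1 psi_max] : exists i1, forall j, psi j <= psi i1.
  case: (@Order.TotalTheory.arg_maxP _ _ _ (Ordinal n_gt0) predT
           (fun i : 'I_n => psi i)) => // i1 _ i1_max; exists i1 => j.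
  have jn : (j %% n < n)%N by rewrite ltn_mod.
  by rewrite -(periodic_mod psi_per); apply: (i1_max (Ordinal jn)).
(* Translation by [d] preserves the set of indices where [psi] is maximal. *)
pose P d := forall i, psi i = psi i1 -> psi (i + d)%N = psi i1.
have P1 : P 1%N.
  rewrite -g1.
  have P0 : P 0%N by move=> i; rewrite addn0.
  have PD c d : P c -> P d -> P (c + d)%N.
    by move=> Pc Pd i /Pc/Pd; rewrite addnA.
  have Pn c k : P (c + k * n)%N -> P c.
    by move=> Pck i /Pck; rewrite addnA (periodicM psi_per).
  (* When the mean of two values is maximal, both values are. *)
  have Pmid i : psi (i + r)%N = psi i1 ->
      psi i = psi i1 /\ psi (i + r + s)%N = psi i1.
    move=> E; have := psi_mid i; have := psi_max i.
    by have := psi_max (i + r + s)%N; rewrite E; lia.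
  have to_i i : (i + r * n.-1 + r = i + r * n)%N.
    by rewrite -addnA -mulnSr prednK.
  (* Modulo [n] this is translation by -r; [Ps] then steps back by [r] and forward by [r + s]. *)
  have Pr' : P (r * n.-1)%N.
    by move=> i E; have [] := Pmid (i + r * n.-1)%N;
      rewrite // to_i (periodicM psi_per).
  have Ps : P s.
    move=> i E; have [|_] := Pmid (i + r * n.-1)%N; rewrite to_i;
      rewrite ?(periodicM psi_per) //.
    by rewrite addnAC (periodicM psi_per).
  (* Modulo [n], translation by [r] is n - 1 translations by -r. *)
  have Pr : P r.
    apply: (Pn _ (r * n.-2)%N).
    have -> : (r + r * n.-2 * n = n.-1 * (r * n.-1))%N.
      by case: n n_gt1 => // -[|m] // _; rewrite /=; nia.
    by elim: {1}n.-1 => // k; rewrite mulSn; apply: PD.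
  have Pnn : P n by apply: (Pn _ 0%N); move=> i; rewrite addn0 psi_per.
  have gcdP c d := @gcdn_closed P n c d P0 PD Pn n_gt0.
  by apply: (gcdP _ _ _ Ps); apply: gcdP.
have psi_const i : psi (i1 + i)%N = psi i1.
  by elim: i => [|i IHi]; rewrite ?addn0 // addnS -addn1; apply: P1.
have {}psi_const i : psi i = psi i1.
  rewrite -(psi_const (i + i1 * n.-1)%N) addnCA -mulnS prednK //.
  by rewrite (periodicM psi_per).
have psum i k : wsum psi i k = psi i1 *+ k.
  rewrite /wsum (eq_bigr (fun=> psi i1)) => [|j _]; last exact: psi_const.
  by rewrite sumr_const card_ord.
have [j] := psi_neq0; apply; rewrite psi_const.
(* For constant [psi] with value c the relation reads r c = s c, so c = 0. *)
have := psi_rel 0%N; rewrite !psum -[LHS]mulr_natr -[RHS]mulr_natr.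
have [//|psi_nz] := eqVneq (psi i1) 0.
by move/(mulfI psi_nz)/eqP; rewrite eqr_nat (negPf r_neq_s).
Qed.

Lemma half_sequence_eq0 r' n' s' (V : zmodType) (h : nat -> V) :
    r = (2 * r')%N -> n = (2 * n')%N -> s = (2 * s')%N ->
    r' = s'.+1 \/ s' = r'.+1 ->
  add_fib_sequence r' n' s' h -> forall i, h i = 0.
Proof.
move=> rE nE sE rs' /add_fib_sequenceP[h_per h_rel].
(* Summed over a period, the relations give r' T = s' T for the total T; as r' and s' differ by 1, T
   = 0 and the partial sums of [h] are periodic. *)
have h_sum c k : \sum_(i < n') wsum h (i + c) k = wsum h 0 n' *+ k.
  rewrite /wsum exchange_big /= (eq_bigr (fun=> wsum h 0 n')) => [|j _].
    by rewrite sumr_const card_ord.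
  rewrite -(wsum_const (c + j) h_per).
  by apply: eq_bigr => i _; rewrite -addnA addnC.
have h_tot : wsum h 0 n' = 0.
  have E : wsum h 0 n' *+ r' = wsum h 0 n' *+ s'.
    rewrite -(h_sum 0%N) -(h_sum r'); apply: eq_bigr => i _.
    by rewrite addn0 h_rel.
  by case: rs' E => ->; rewrite mulrSr;
    [move/(canRL (addKr _)) | move/esym/(canRL (addKr _))]; rewrite addNr.
have W_per i : wsum h 0 (i + n') = wsum h 0 i.
  by rewrite wsumD add0n wsum_const // h_tot addr0.
(* In the first coordinate, neighbours add up alternately to a term of [h] and to 0; the signs in
   the second will force [c] to vanish. *)
pose a i : V * int :=
  if odd i then (wsum h 0 i./2.+1, -1) else (- wsum h 0 i./2, 1).
have a_even j : a j.*2 = (- wsum h 0 j, 1) by rewrite /a odd_double doubleK.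
have a_odd j : a j.*2.+1 = (wsum h 0 j.+1, -1).
  by rewrite /a /= odd_double uphalf_double.
have sum_even j k : wsum a j.*2 (2 * k) = (wsum h j k, 0).
  rewrite wsum_double; elim: k => [|k IHk]; first by rewrite big_ord0 wsum0.
  rewrite big_ord_recr IHk addnS -doubleD a_even a_odd; congr (_, _) => //=.
  by rewrite wsumS add0n addKr -wsumS.
have sum_odd j k : wsum a j.*2.+1 (2 * k) = 0.
  rewrite wsum_double big1 // => i _.
  rewrite addSn addnS addSn -doubleD -doubleS a_odd a_even.
  by congr (_, _); rewrite /= addrN.
have a_fib : add_fib_sequence r n s a.
  apply/add_fib_sequenceP; split=> i; rewrite -[i]odd_double_half.
    rewrite nE mul2n -addnA -doubleD; case: odd; rewrite ?add1n ?add0n.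
      by rewrite !a_odd -addSn W_per.
    by rewrite !a_even W_per.
  rewrite sE {2}rE [in X in _ = wsum _ X _]mul2n -addnA -doubleD rE.
  by case: odd; rewrite ?add1n ?add0n ?sum_odd ?sum_even ?h_rel.
have [[c d] aE] := psi_univ a_fib.
have fstM (m : int) : ((c, d) *~ m).1 = c *~ m by exact: (raddfMz fst).
have sndM (m : int) : ((c, d) *~ m).2 = d *~ m by exact: (raddfMz snd).
(* At index 0 the second coordinate gives d psi(0) = 1, the first c psi(0) = 0. *)
have c0 : c = 0.
  have := congr1 snd (aE 0%N); rewrite sndM /= => d1.
  have := congr1 fst (aE 0%N); rewrite fstM /= wsum0 oppr0 => c1.
  by rewrite -[LHS]mulr1z d1 mulrzz mulrC mulrzA -c1 mul0rz.
have W0 i : wsum h 0 i.+1 = 0.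
  by have := congr1 fst (aE i.*2.+1); rewrite a_odd fstM c0 mul0rz.
move=> i; have := W0 i; rewrite wsumS add0n.
by case: i => [|i]; rewrite ?wsum0 ?W0 add0r.
Qed.

End CyclicSequences.

(** * Periodic Fibonacci sequences modulo a prime *)

Section Fibonacci.
Local Open Scope ring_scope.

(** The Fibonacci numbers F(k-1) and F(k), with F(-1) = 1. *)
Fixpoint fib_pair (k : nat) : nat * nat :=
  if k is k'.+1 then ((fib_pair k').2, (fib_pair k').1 + (fib_pair k').2)%N
  else (1, 0)%N.

Lemma fib_pair_Cassini k (A := (fib_pair k).1%:Z) (B := (fib_pair k).2%:Z) :
  A * (A + B) - B ^+ 2 = (-1) ^+ k.
Proof.
rewrite {}/A {}/B; elim: k => //= k; set A := (fib_pair k).1.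
by set B := (fib_pair k).2; rewrite [_ ^+ k.+1]exprS => <-; rewrite PoszD; ring.
Qed.

Lemma fib_pair_ge k :
  (2 < k)%N -> (1 <= (fib_pair k).1)%N /\ (2 <= (fib_pair k).2)%N.
Proof.
case: k => [|[|[|k]]] // _; elim: k => // k [].
by move: (k.+3) => m /=; lia.
Qed.

(** A sequence of period [m] is a fixed vector of the [m]-th power of the Fibonacci matrix. It
    exists modulo any prime dividing [D], the determinant of that power minus the identity. *)
Lemma periodic_fibonacci m : (2 < m)%N ->
  exists p (b : nat -> 'F_p),
    [/\ forall i, b (i + m)%N = b i,
        forall i, b i.+2 = b i + b i.+1 & exists i, b i <> 0].
Proof.
move=> m_gt2; have [A_ge1 B_ge2] := fib_pair_ge m_gt2.
have := fib_pair_Cassini m.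
case mE : (fib_pair m) A_ge1 B_ge2 => [A B] /= A_ge1 B_ge2 cassini.
pose D : int := (A%:Z - 1) * (A%:Z + B%:Z - 1) - B%:Z ^+ 2.
have D_ge2 : (1 < absz D)%N.
  (* The bounds on [A] and [B] make this at most -2. *)
  have -> : D = (-1) ^+ m - (2 * A%:Z + B%:Z) + 1 by rewrite -cassini /D; ring.
  by rewrite -signr_odd; case: odd; rewrite ?expr0 ?expr1; lia.
pose p := pdiv (absz D); exists p.
have p_pr : prime p := pdiv_prime D_ge2.
have D0 : (A%:R - 1) * (A%:R + B%:R - 1) = B%:R ^+ 2 :> 'F_p.
  apply/subr0_eq.
  have -> : (A%:R - 1) * (A%:R + B%:R - 1) - B%:R ^+ 2 = D%:~R :> 'F_p.
    by rewrite /D !(rmorphB, rmorphM, rmorphD, rmorphXn) /=.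
  have /dvdnP[k Dk] := pdiv_dvd (absz D).
  have p0 : p%:R = 0 :> 'F_p by rewrite pchar_Fp_0.
  by rewrite [D]intEsg intrM Dk -pmulrn natrM p0 !mulr0.
pose b (u v : 'F_p) k : 'F_p := (fib_pair k).1%:R * u + (fib_pair k).2%:R * v.
have b_rec u v i : b u v i.+2 = b u v i + b u v i.+1.
  by rewrite /b /= !natrD; ring.
suff [u [v [uv0 bm bm1]]] : exists u v : 'F_p,
    [/\ (u != 0) || (v != 0), b u v m = b u v 0%N & b u v m.+1 = b u v 1%N].
  exists (b u v); split=> // [i|].
    suff [] : b u v (i + m)%N = b u v i /\ b u v (i.+1 + m)%N = b u v i.+1 by [].
    elim: i => // i [IH1 IH2]; split=> //.
    by rewrite !addSn !b_rec IH1 -IH2.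
  case/orP: uv0 => /eqP nz; [exists 0%N | exists 1%N];
    by rewrite /b /= ?mul1r ?mul0r ?addr0 ?add0r.
rewrite /b /= mE /=.
have [B0|B_neq0] := eqVneq (B%:R : 'F_p) 0.
  exists 1, 0; rewrite oner_neq0 natrD B0.
  have A1 : A%:R = 1 :> 'F_p.
    move: D0; rewrite B0 addr0 expr0n -expr2 => /eqP.
    by rewrite sqrf_eq0 subr_eq0 => /eqP.
  by rewrite A1; split=> //; ring.
(* This vector is killed by the first row of the singular matrix, hence by the second too. *)
exists B%:R, (1 - A%:R); rewrite B_neq0; split=> //; first ring.
rewrite natrD; apply/subr0_eq.
transitivity (B%:R ^+ 2 - (A%:R - 1) * (A%:R + B%:R - 1) : 'F_p); first ring.
by rewrite D0 subrr.
Qed.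

Lemma fib_sequence21_neq0 m : (2 < m)%N ->
  exists p (h : nat -> 'F_p), add_fib_sequence 2 m 1 h /\ exists i, h i <> 0.
Proof.
move=> /periodic_fibonacci[p [b [b_per b_rec b_neq0]]]; exists p, b; split=> //.
apply/add_fib_sequenceP; split=> // i.
by rewrite !wsumS !wsum0 !add0r addn0 addn1 addn2 addn0 b_rec.
Qed.

(* Reversing time turns b(i+2) = b(i) + b(i+1) into b(i) = b(i+1) + b(i+2); a
   sequence of period m is reversed by i |-> (m - 1) i. *)
Lemma fib_sequence12_neq0 m : (2 < m)%N ->
  exists p (h : nat -> 'F_p), add_fib_sequence 1 m 2 h /\ exists i, h i <> 0.
Proof.
move=> m_gt2.
have [p [b [b_per b_rec [i bi]]]] := periodic_fibonacci m_gt2.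
have bM k j : b (j + k * m)%N = b j := periodicM b_per k j.
exists p, (fun i => b (m.-1 * i)%N); split; last first.
  (* As (m - 1)^2 is 1 mod m, the reversal returns this index to [i]. *)
  exists (i * m.-1)%N; rewrite (_ : (_ * _)%N = i + (i * m.-2) * m)%N ?bM //.
  by case: m m_gt2 {b_per b_rec bM} => [|[|m]] //= _; nia.
apply/add_fib_sequenceP; split=> j; first by rewrite mulnDr bM.
rewrite !wsumS !wsum0 !add0r !addn0 addn1.
rewrite -(bM 2%N (m.-1 * j)%N) -(bM 1%N (m.-1 * j.+1)%N).
rewrite (_ : _ + 2 * m = (m.-1 * (j.+1 + 1)).+2)%N ?b_rec; last by nia.
by rewrite addrC (_ : _ + 1 * m = (m.-1 * (j.+1 + 1)).+1)%N //; nia.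
Qed.

End Fibonacci.

(** * The infinite cyclic case *)

Section CaseZ.
Local Open Scope group_scope.
Variables (G : groupType) (r n s : nat) (x : nat -> G).
Hypothesis n_gt0 : 0 < n.
Hypothesis x_fib : fib_sequence r n s x.

(** Up to a shift by a multiple of [n], the shorter side of a relation is a prefix or suffix of the
    longer one; cancelling it leaves two letters. *)
Lemma pair_window_eq1 : r = s.+2 \/ s = r.+2 ->
  n %| r \/ n %| s -> forall i, window x i 2 = 1.
Proof.
have [x_per x_rel] := x_fib.
have shift k i m : n %| k -> window x (i + k) m = window x i m.
  by case/dvdnP=> c ->; rewrite (periodicM (a := fun i => window x i m)) // => j;
    exact: window_period.
suff key c : (forall i, window x (i + c) 2 = 1) -> forall i, window x i 2 = 1.
  move=> rs rs_n; case: rs => E; case: rs_n => dv.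
  - apply: (key s) => i; apply: (mulgI (window x i s)).
    by rewrite -windowD addn2 -E mulg1 x_rel shift.
  - apply: (key 0) => i; apply: (mulIg (window x (i + 2) s)).
    by rewrite addn0 -windowD add2n -E mul1g x_rel E -addn2 addnA addnAC shift.
  - apply: (key r) => i; apply: (mulgI (window x i r)).
    by rewrite -windowD addn2 -E mulg1 x_rel shift.
  - apply: (key r) => i; apply: (mulIg (window x (i + r + 2) r)).
    by rewrite -windowD add2n -E mul1g -x_rel -addnA addn2 -E shift.
move=> xc i; rewrite -(shift (c * n)%N) ?dvdn_mull //.
by rewrite -(xc (i + c * n.-1)%N) -addnA -mulnSr prednK.
Qed.

End CaseZ.

Section PowersOfInt.
Local Open Scope group_scope.

Definition zexpg (G : groupType) (x : G) (k : int) : G :=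
  match k with Posz m => x ^+ m | Negz m => x ^- m.+1 end.

Lemma zexpgB (G : groupType) (x : G) (m k : nat) :
  zexpg x (m%:Z - k%:Z)%R = x ^+ m / x ^+ k.
Proof.
have [km|mk] := leqP k m; first by rewrite subzn //= expgnFr.
have -> : (m%:Z - k%:Z = Negz (k - m).-1)%R by lia.
by rewrite /= prednK ?subn_gt0 // expgnFr ?invgF // ltnW.
Qed.

Lemma zexpgD (G : groupType) (x : G) :
  {morph zexpg x : k l / (k + l)%R >-> k * l}.
Proof.
have intB (k : int) : exists m p : nat, k = (m%:Z - p%:Z)%R.
  by case: k => m; [exists m, 0%N | exists 0%N, m.+1]; lia.
move=> k l; have [m [p ->]] := intB k; have [m' [p' ->]] := intB l.
have -> : (m%:Z - p%:Z + (m'%:Z - p'%:Z) =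
            (m + m')%N%:Z - (p + p')%N%:Z)%R by lia.
rewrite !zexpgB !expgnDr.
have c1 : commute (x ^+ m') (x ^- p) by apply/commuteV/commuteX2/commute_refl.
have c2 : commute (x ^+ p) (x ^+ p') by apply/commuteX2/commute_refl.
by rewrite c2 invgM -!mulgA; congr (_ * _); rewrite !mulgA c1.
Qed.

End PowersOfInt.

(** Neighbouring generators are inverse to each other, so x_0 generates; the alternating sequence 1,
    -1, ... gives the map to the integers. *)
Lemma gen_fib_group_Z r n s : 0 < n -> ~~ odd r -> ~~ odd n -> ~~ odd s ->
    r = s.+2 \/ s = r.+2 -> n %| r \/ n %| s ->
  isomorphic_to_Z (gen_fib_group r n s).
Proof.
move=> n_gt0 r_even n_even s_even rs rs_n.
have [x [x_fib x_gen x_lift]] := gen_fib_groupP r s n_gt0.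
have xx i : (x i * x i.+1 = 1)%g.
  have := pair_window_eq1 n_gt0 x_fib rs rs_n i.
  by rewrite !windowS window0 mul1g addn0 addn1.
pose a i : int := ((-1) ^+ (odd i))%R.
have a_fib : add_fib_sequence r n s a.
  have a_sum i k : ~~ odd k -> wsum a i k = 0%R.
    move=> k_even; rewrite -[k]odd_double_half (negPf k_even) add0n -mul2n.
    rewrite wsum_double big1 // => j _.
    by rewrite /a addnS /= oddD odd_double addbF; case: odd.
  apply/add_fib_sequenceP; split=> i; last by rewrite !a_sum.
  by rewrite /a oddD (negPf n_even) addbF.
have [f fE] := x_lift (Algebra.to_multiplicative int) a a_fib.
have [g gE] :=
  @gmorph_of_morph (Algebra.to_multiplicative int) _ _ (zexpgD (x 0%N)).
exists f; first by move=> y z; rewrite gmulfM.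
exists g => [y|k].
  have [e eE] :=
    gmorph_of_morph (f := @idfun (gen_fib_group r n s)) (fun _ _ => erefl).
  rewrite -[RHS]/(idfun y) -eE; apply: (x_gen _ (g \o f) e) => j.
  rewrite /= fE gE eE /a; elim: j => //= j IHj.
  apply: (mulgI (x j)); rewrite xx -[X in (X * _)%g]IHj.
  by case: odd; rewrite /= ?expg1 ?mulgV ?mulVg.
have fX m : f (x 0%N ^+ m)%g = Posz m.
  elim: m => [|m IHm]; first exact: gmulf1.
  by rewrite expgS gmulfM fE IHm; exact: esym (intS m).
rewrite gE; case: k => k; first exact: fX.
by rewrite /= gmulfV fX.
Qed.

(** * The torus knot case *)

Section TorusKnot.
Local Open Scope group_scope.

Lemma torus_knot_groupP r n : exists a b : torus_knot_group r n,
  [/\ a ^+ n = b ^+ r,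
      forall (H : groupType) (f g : {gmorph torus_knot_group r n -> H}),
        f a = g a -> f b = g b -> f =1 g
    & forall (H : groupType) (a' b' : H), a' ^+ n = b' ^+ r ->
        exists f : {gmorph torus_knot_group r n -> H}, f a = a' /\ f b = b'].
Proof.
exists (pres_gen _ true), (pres_gen _ false); split.
- apply: divg1_eq; rewrite -!gmulfXn -gmulfF; exact: pres_rel.
- by move=> H f g fa fb; apply: pres_gmorph_ext => -[].
- move=> H a' b' ab.
  have [f fE] := free_lift (fun c : bool => if c then a' else b').
  have [|g gE] := @pres_lift _
    [set free_gen true ^+ n / free_gen false ^+ r]%classic _ f.
    by move=> _ ->; rewrite gmulfF !gmulfXn !fE ab mulgV.
  by exists g; rewrite !gE !fE.
Qed.

Lemma window_telescope (G : groupType) (P : nat -> G) i k :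
  window (fun j => (P j)^-1 * P j.+1) i k = (P i)^-1 * P (i + k)%N.
Proof.
elim: k => [|k IHk]; first by rewrite window0 addn0 mulVg.
by rewrite windowS IHk addnS -mulgA mulVKg.
Qed.

Lemma gen_fib_group_torus r n : 0 < r -> 0 < n -> gcdn r n = 1%N ->
  isomorphic (gen_fib_group r n r) (torus_knot_group r n).
Proof.
move=> r_gt0 n_gt0 rn.
have [x [x_fib x_gen x_lift]] := gen_fib_groupP r r n_gt0.
have [a [b [ab t_gen t_lift]]] := torus_knot_groupP r n.
have [u v uv _] := egcdnP n r_gt0; rewrite rn addn1 in uv.
have [x_per x_rel] := x_fib.
pose y := window x 0 r; pose w := window x 0 n.
(* Windows of length [r] are unchanged under shifts by [r] and by [n], hence by gcd(r,n) = 1. *)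
have yE i : window x i r = y.
  suff P1 j : window x (j + 1) r = window x j r.
    by elim: i => // i <-; rewrite -addn1 P1.
  move: j; rewrite -rn; apply: (gcdn_closed (n := n)
    (P := fun d => forall j, window x (j + d) r = window x j r)) => //.
  - by move=> j; rewrite addn0.
  - by move=> c d Pc Pd j; rewrite addnA Pd Pc.
  - move=> c k Pc j; rewrite -[RHS]Pc addnA.
    rewrite (periodicM (a := fun j => window x j r)) // => l.
    exact: window_period.
  - by move=> j; rewrite window_period.
(* The word x_0...x_(rn-1) is cut into pieces of length [r] or of length [n]. *)
have yw : y ^+ n = w ^+ r.
  rewrite -(windowX 0 n (a := x) (d := r)) => [|j]; last by rewrite !yE.
  rewrite mulnC windowX // => j; exact: window_period.
(* The formula for the prefix of length [k], stated for any group because both groups need it. *)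
pose Q (G : groupType) (c d : G) k := (d ^+ (v * k))^-1 * c ^+ (u * k).
have Qn (G : groupType) (c d : G) k :
    c ^+ n = d ^+ r -> Q G c d (k + n)%N = d * Q G c d k.
  move=> cd; rewrite /Q [(u * (k + n))%N]mulnDr [in c ^+ _]addnC expgnDr.
  rewrite (mulnC u) expgnA cd -expgnA (mulnC r) uv !mulgA; congr (_ * _).
  apply: (mulgI (d ^+ (v * (k + n)))); apply: (mulIg (d ^+ (v * k))).
  rewrite mulVKg !mulgA mulgVK -expgnDr -expgSr; congr (_ ^+ _).
  by rewrite mulnDr addSn addnC.
have Qr (G : groupType) (c d : G) k :
    c ^+ n = d ^+ r -> (Q G c d k)^-1 * Q G c d (k + r)%N = c.
  move=> cd; rewrite /Q (mulnDr v) (addnC (v * k)%N) expgnDr (mulnC v r) expgnA -cd.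
  rewrite -expgnA (mulnC n) mulnDr uv addnS -addSn addnC expgnDr !invgM invgK.
  by rewrite -!mulgA mulVKg mulKg expgSr mulKg.
have xQ k : window x 0 k = Q _ y w k.
  elim: k => [|k IHk]; first by rewrite window0 /Q !muln0 expg0 invg1 mulg1.
  (* The word of length vn + k + 1 = k + ur is cut in two ways. *)
  have : w ^+ v * window x 0 k.+1 = window x 0 k * y ^+ u.
    rewrite -(yE k) -windowX => [|j]; last by rewrite !yE.
    rewrite -windowD uv addnS -addSn addnC windowD windowX; last first.
      by move=> j; exact: window_period.
    by rewrite (periodicM (a := fun j => window x j k.+1)) // => j;
      exact: window_period.
  rewrite IHk => /(canRL (mulKg _)) ->.
  by rewrite /Q !mulnSr !expgnDr invgM !mulgA.
(* Generators are quotients of consecutive prefixes, so windows of [z] telescope. *)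
pose z k := (Q _ a b k)^-1 * Q _ a b k.+1.
have z_fib : fib_sequence r n r z.
  split=> i; first by rewrite /z -addSn !Qn // invgM mulgA mulgVK.
  by rewrite !window_telescope !Qr.
have [f fE] := x_lift _ z z_fib.
have [g [ga gb]] := t_lift _ y w yw.
have gQ k : g (Q _ a b k) = Q _ y w k.
  by rewrite /Q gmulfM gmulfV !gmulfXn ga gb.
have fx : f \o x = z by apply/funext => j; exact: fE.
have [e eE] :=
  gmorph_of_morph (f := @idfun (gen_fib_group r n r)) (fun _ _ => erefl).
have [e' e'E] :=
  gmorph_of_morph (f := @idfun (torus_knot_group r n)) (fun _ _ => erefl).
apply: (@isomorphic_of_can _ _ f g) => t.
  rewrite -[RHS]/(idfun t) -eE; apply: (x_gen _ (g \o f) e) => j.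
  rewrite eE /= fE gmulfM gmulfV !gQ -!xQ windowS add0n; exact: mulKg.
rewrite -[RHS]/(idfun t) -e'E; apply: (t_gen _ (f \o g) e').
  by rewrite e'E /= ga gmulf_window fx window_telescope Qr.
by rewrite e'E /= gb gmulf_window fx window_telescope Qn // /Q !muln0 expg0
  invg1 !mulg1 invg1 mul1g.
Qed.

End TorusKnot.

(** * The arithmetic case distinction *)

Theorem theorem1 (r n s : nat) (r_ge1 : 1 <= r) (s_ge1 : 1 <= s)
    (n_ge2 : 2 <= n) :
  connected_LOG_group (gen_fib_group r n s) ->
  [\/ [/\ r = s, gcdn r n = 1
        & isomorphic (gen_fib_group r n s) (torus_knot_group r n)],
      [/\ gcdn (gcdn r n) s = 2, `|r - s|%N = 2,
          r = 0 %[mod n] \/ s = 0 %[mod n]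
        & isomorphic_to_Z (gen_fib_group r n s)]
    | [/\ gcdn (gcdn r n) s = 2 /\ `|r - s|%N = 2,
          [set r; s]%classic <> [set 4; 2]%classic,
          gcdn n (r + s) = 2,
          r <> 0 %[mod n] /\ s <> 0 %[mod n]
        & perfect (gen_fib_group (r %/ 2) (n %/ 2) (s %/ 2))]].
Proof.
have n_gt0 := ltnW n_ge2.
case/(connected_LOG_sequence n_gt0) => psi [psi_fib psi_neq0 psi_univ].
have g_le2 := gcdn_le2 psi_univ.
have half_modn := psi_half_modn psi_univ.
have g_dvd : gcdn (gcdn r n) s %| gcdn n (r + s).
  rewrite dvdn_gcd (dvdn_trans (dvdn_gcdl _ _) (dvdn_gcdr _ _)) dvdn_add //.
    exact: dvdn_trans (dvdn_gcdl _ _) (dvdn_gcdl _ _).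
  exact: dvdn_gcdr.
have g'_gt0 : 0 < gcdn n (r + s) by rewrite gcdn_gt0 n_gt0.
have g_gt0 : 0 < gcdn (gcdn r n) s by rewrite !gcdn_gt0 r_ge1.
have g_le_g' := dvdn_leq g'_gt0 g_dvd.
have even_of_g2 : gcdn (gcdn r n) s = 2 -> [/\ ~~ odd r, ~~ odd n & ~~ odd s].
  by move=> g2; split; rewrite -dvdn2 -g2 ?dvdn_gcdr //;
    apply: dvdn_trans (dvdn_gcdl _ _) _; rewrite ?dvdn_gcdl ?dvdn_gcdr.
have [rs|r_neq_s] := eqVneq r s.
  have gE : gcdn (gcdn r n) s = gcdn r n by rewrite -rs gcdnAC gcdnn.
  have g_neq2 : gcdn r n <> 2.
    rewrite -gE => /even_of_g2[r_even n_even s_even].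
    by apply: (half_modn 2); rewrite // -rs.
  have rn1 : gcdn r n = 1 by lia.
  by apply: Or31; split=> //; rewrite -rs; apply: gen_fib_group_torus.
have g2 : gcdn (gcdn r n) s = 2.
  have := gcdn_neq1 n_ge2 psi_fib psi_neq0 r_neq_s.
  lia.
have [r_even n_even s_even] := even_of_g2 g2.
have rE : r = 2 * (r %/ 2) by rewrite divn2 mul2n even_halfK.
have nE : n = 2 * (n %/ 2) by rewrite divn2 mul2n even_halfK.
have sE : s = 2 * (s %/ 2) by rewrite divn2 mul2n even_halfK.
(* The halves are congruent modulo their own difference, so that difference cannot exceed 1. *)
have half_rs : r %/ 2 = (s %/ 2).+1 \/ s %/ 2 = (r %/ 2).+1.
  move: half_modn; rewrite -!divn2.
  set r' := r %/ 2 in rE *; set s' := s %/ 2 in sE * => half_modn.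
  have [lt_rs|lt_sr|//] := ltngtP r' s'; last by lia.
    right; have [//|] := eqVneq s' r'.+1 => ne.
    have q_gt1 : 1 < s' - r' by lia.
    case: (half_modn _ q_gt1) => //.
    by rewrite -[LHS]modnDl subnK // ltnW.
  left; have [//|] := eqVneq r' s'.+1 => ne.
  have q_gt1 : 1 < r' - s' by lia.
  case: (half_modn _ q_gt1) => //.
  by rewrite -[RHS]modnDl subnK // ltnW.
have rs2 : r = s.+2 \/ s = r.+2 by lia.
have dist2 : `|r - s|%N = 2 by lia.
have [rs_n|/not_orP[r_n s_n]] := pselect (n %| r \/ n %| s).
  apply: Or32; split=> //; last exact: gen_fib_group_Z.
  by case: rs_n => /eqP E; [left | right]; rewrite E mod0n.
have half0 := half_sequence_eq0 psi_univ rE nE sE half_rs.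
apply: Or33; split=> //.
- move=> rs42.
  have r42 : r = 4 \/ r = 2.
    by have : [set r; s]%classic r by [left]; rewrite rs42.
  have s42 : s = 4 \/ s = 2.
    by have : [set r; s]%classic s by [right]; rewrite rs42.
  (* Otherwise [n] is 2 or 4 and divides [r] or [s]. *)
  have n_gt2 : 2 < n %/ 2.
    rewrite ltnNge; apply/negP => n_le2.
    have [E|E] : n = 2 \/ n = 4 by lia.
      by apply: r_n; rewrite rE E dvdn_mulr.
    have [r4|s4] : r = 4 \/ s = 4 by clear half0; lia.
      by apply: r_n; rewrite r4 E.
    by apply: s_n; rewrite s4 E.
  case: r42 => r42.
    have [p [h [h_fib [i]]]] := fib_sequence21_neq0 n_gt2; apply.
    apply: half0; rewrite r42; have -> : s = 2 by lia.
    exact: h_fib.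
  have [p [h [h_fib [i]]]] := fib_sequence12_neq0 n_gt2; apply.
  apply: half0; rewrite r42; have -> : s = 4 by lia.
  exact: h_fib.
- have : 2 %| gcdn n (r + s) by rewrite -g2.
  by case: (gcdn n (r + s)) g'_gt0 g_le2 => [|[|[|]]].
- split; [move=> E; apply: r_n | move=> E; apply: s_n]; by rewrite /dvdn E mod0n.
- by apply: perfect_gen_fib_group => //; lia.
Qed.
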